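(* Let $(G,X,x_0)$ be a $0$-dimensional ambit. If the $G$-ambit $X$ has sep. fin. EDRdeg, then every distal minimal factor of $(G,X)$ is a profinite flow (i.e. an inverse limit of finite $G$-flows).
   Context: Compact spaces are Hausdorff. A flow $(G,X)$ is a topological group $G$ acting continuously on a compact space $X$. An ambit $(G,X,x_0)$ is a flow with a distinguished point $x_0\in X$ whose orbit is dense; it is $0$-dimensional if $X$ has a basis of clopen sets. $\mathcal{B}$ denotes the algebra of clopen subsets of $X$. A factor of $(G,X)$ is a flow $(G,Y)$ for which there is a $G$-flow epimorphism (continuous $G$-equivariant surjection) $X\to Y$. A flow is distal if for any points $x\neq y$ there is no net $(g_i)$ in $G$ with $\lim_i g_ix=\lim_i g_iy$. A coloring is a function $c\colon G\to 2^n$, $n\ge 1$. For $\Sigma\subseteq\mathcal{B}$, $c$ is an externally definable $\Sigma$-coloring if there are $U_0,\dots,U_{n-1}\in\Sigma$ and $y_0,\dots,y_{n-1}\in X$ such that for all $g\in G$, $i<n$: $c(g)(i)=1$ if $y_i\in gU_i$ and $c(g)(i)=0$ if $y_i\notin gU_i$. The ambit has separately finite externally definable Ramsey degree (sep. fin. EDRdeg) if for every finite $\Sigma\subseteq\mathcal{B}$ there is $l\ge 1$ such that for every externally definable $\Sigma$-coloring $c\colon G\to 2^n$ (any $n\geq 1$), every $k\ge 1$ and every $k$-element $A\subseteq G$, there is $h\in G$ with $|c[hA]|\le l$. *)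

(* Defs.v *)
From HB Require Import structures.
From mathcomp Require Import all_boot all_order finmap.
From mathcomp Require Import all_classical.
From mathcomp Require Import topology.

Set Implicit Arguments.
Unset Strict Implicit.
Unset Printing Implicit Defensive.

Local Open Scope classical_set_scope.

HB.mixin Record isTopologicalGroup G of Topological G & Group G := {
  mulg_continuous : continuous (fun p : G * G => (p.1 * p.2)%g);
  invg_continuous : continuous (fun g : G => (g^-1)%g)
}.

#[short(type="topologicalGroupType")]
HB.structure Definition TopologicalGroup :=
  {G of Topological G & Group G & isTopologicalGroup G}.

HB.mixin Record isFlow (G : topologicalGroupType) X of Topological X := {
  gact : G -> X -> X;
  gact1 : forall x, gact 1%g x = x;
  gactM : forall g h x, gact (g * h)%g x = gact g (gact h x);
  gact_continuous : continuous (fun p : G * X => gact p.1 p.2);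
  flow_compact : compact [set: X];
  flow_hausdorff : hausdorff_space X
}.

#[short(type="flowType")]
HB.structure Definition Flow (G : topologicalGroupType) :=
  {X of Topological X & isFlow G X}.

(* Directed sets index both nets and inverse systems; as usual for nets, the
   order is only required to be a preorder. *)
Record directedSet := DirectedSet {
  dset :> Type;
  dle : dset -> dset -> Prop;
  dle_refl : forall i, dle i i;
  dle_trans : forall i j k, dle i j -> dle j k -> dle i k;
  dset_inhabited : inhabited dset;
  dset_directed : forall i j, exists k, dle i k /\ dle j k
}.

(* [u i @[i --> tails I] --> x] says that the net [u] indexed by [I]
   converges to [x]. *)
Definition tails (I : directedSet) : set_system I :=
  filter_from [set: I] (fun i => [set j | dle i j]).
Arguments tails : clear implicits.

Section Flows.
Context {G : topologicalGroupType}.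
Implicit Types X Y : flowType G.

Definition ambit X (x0 : X) : Prop := dense (range (fun g : G => gact g x0)).

Definition has_clopen_basis (T : topologicalType) : Prop :=
  exists2 B : set (set T), B `<=` clopen & basis B.

Definition flow_morphism X Y (f : X -> Y) : Prop :=
  continuous f /\ forall (g : G) x, f (gact g x) = gact g (f x).

Definition flow_factor X Y : Prop :=
  exists2 f : X -> Y, flow_morphism f & range f = [set: Y].

(* The empty flow is not minimal. *)
Definition minimal_flow X : Prop :=
  [set: X] !=set0 /\
  forall A : set X, closed A -> A !=set0 ->
    (forall (g : G) x, A x -> A (gact g x)) -> A = [set: X].

Definition distal X : Prop :=
  forall x y : X, x <> y ->
    ~ exists (I : directedSet) (g : I -> G) (z : X),
        gact (g i) x @[i --> tails I] --> z /\
        gact (g i) y @[i --> tails I] --> z.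

Record inverse_system := InverseSystem {
  isys_index : directedSet;
  isys_obj : isys_index -> flowType G;
  isys_map : forall i j : isys_index, dle i j -> isys_obj j -> isys_obj i;
  isys_map_morphism : forall i j (ij : dle i j), flow_morphism (isys_map ij);
  isys_map_id : forall i (ii : dle i i) x, isys_map ii x = x;
  isys_map_comp : forall i j k (ij : dle i j) (jk : dle j k) (ik : dle i k) x,
    isys_map ij (isys_map jk x) = isys_map ik x
}.

Definition thread (S : inverse_system)
    (x : prod_topology (fun i => isys_obj (i : isys_index S))) : Prop :=
  forall i j (ij : dle i j), isys_map ij (x j) = x i.

(* [Y] is isomorphic to the space of threads of [S], a subspace of the product
   on which [G] acts coordinatewise: the isomorphism sends [y] to
   [fun i => p i y]; it is an equivariant bijection onto the threads, and it is
   a homeomorphism because [Y] carries the topology it induces. *)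
Definition inverse_limit (S : inverse_system) Y : Prop :=
  exists p : forall i : isys_index S, Y -> isys_obj i,
    let phi : Y -> prod_topology (fun i => isys_obj (i : isys_index S)) :=
      fun y i => p i y in
    [/\ forall i, flow_morphism (p i),
        injective phi,
        range phi = [set x | thread x]
      & @open Y = @open (initial_topology phi)].

Definition profinite_flow Y : Prop :=
  exists2 S : inverse_system,
    forall i : isys_index S, finite_set [set: isys_obj i] & inverse_limit S Y.

(* A coloring [c : G -> 2^n] takes values in [{ffun 'I_n -> bool}]. *)
Definition ext_definable_coloring X (Sigma : set (set X)) (n : nat)
    (c : G -> {ffun 'I_n -> bool}) : Prop :=
  exists (U : 'I_n -> set X) (y : 'I_n -> X),
    (forall i, Sigma (U i)) /\
    forall (g : G) (i : 'I_n), c g i = `[< (gact g @` U i) (y i) >].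

Definition sep_fin_EDRdeg X : Prop :=
  forall Sigma : set (set X), finite_set Sigma -> Sigma `<=` clopen ->
    exists2 l : nat, 1 <= l &
      forall (n : nat) (c : G -> {ffun 'I_n -> bool}), 1 <= n ->
        ext_definable_coloring Sigma c ->
        forall (k : nat) (A : {fset G}), 1 <= k -> #|` A|%fset = k ->
          exists h : G, #|` [fset c (h * a)%g | a in A]|%fset <= l.

End Flows.

(* Main.v *)
Require Import Defs.
From HB Require Import structures.
From mathcomp Require Import all_boot all_order finmap.
From mathcomp Require Import all_classical.
From mathcomp Require Import fingroup perm.
From mathcomp Require Import topology.

Set Implicit Arguments.
Unset Strict Implicit.
Unset Printing Implicit Defensive.

Local Open Scope classical_set_scope.

(** Let [f : X -> Y] be the factor map. It suffices to find, for every [y] in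
    an open set [W] of [Y], a [G]-invariant partition of [Y] into finitely many
    clopen cells such that the cell of [y] lies inside [W]: the finite quotient
    flows by such partitions form an inverse system with limit [Y]
    ([profinite_of_partitions]). Choose a clopen [U] of [X] that contains
    [f @^-1` [set y]] and lies inside [f @^-1` W].

    The Ramsey hypothesis is used for [Sigma = {U}] only. Let [E] be the Ellis
    semigroup of [X], the closure of [G] in [X ^ X]. Applied to all finite sets
    of points of [X] and of elements of [G] at once, and passing to a cluster
    point of the inverses of the elements [h], the hypothesis yields some [eta]
    in [E] for which the set of traces [(xi \o eta) @^-1` U], [xi] in [E], is
    finite ([EDRdeg_finite_traces]). Choose [eta] with the least number of
    traces. The closed left ideal [E eta] contains an idempotent [eps]
    ([ellis_numakura]), and for a distal factor [f \o eps = f]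
    ([distal_factor_idempotent]). By minimality, each [zeta] in [E eps] acts on
    the finite set of traces of [eps], by preimages, as a permutation
    ([trace_rel_total]).

    Each [g] in [G] acts on [Y] in the same way as some [zeta] in [E eps]
    (namely [g eps]), but [zeta] is not unique, so that a relation rather than
    a homomorphism from [G] to a finite permutation group results. It is
    multiplicative, and this is enough for the elements of [G] that are related
    to the identity permutation to form a normal subgroup [N] of finite index.
    If [n] in [N] is represented by [zeta] and [f x = y], then [eps x] lies in
    [U], hence so does [eps (zeta x)], whose image is [n y]. Thus [N y]
    stays inside the closed set [f @` U], a subset of [W]. As [Y] is minimal
    and [N] is normal of finite index, the closures of the [N]-orbits form the
    required partition ([orbit_closure_partition]). *)

(** * Topological preliminaries *)

(** Compactness for families of sets that are closed under binary unions. If no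
    member covers [A], the sets [A `\` V] generate a proper filter on [A], and
    a cluster point of it is not in the interior of any member. *)
Lemma compact_directed_cover (T : topologicalType) (A : set T)
    (P : set (set T)) :
  compact A -> P set0 -> (forall V W, P V -> P W -> P (V `|` W)) ->
  (forall x, A x -> exists2 V, P V & nbhs x V) ->
  exists2 V, P V & A `<=` V.
Proof.
move=> Aco P0 PU cov; apply: contrapT => noV.
pose F := filter_from P (fun V => A `\` V).
have FF : ProperFilter F.
  apply: filter_from_proper.
    apply: filter_from_filter; first by exists set0.
    move=> V W PV PW; exists (V `|` W); first exact: PU.
    by move=> x [Ax nVW]; split; split=> // ?; apply: nVW; [left|right].
  move=> V PV; apply: contrapT => /set0P/negP; rewrite negbK => /eqP AV0.
  apply: noV; exists V => // x Ax; apply: contrapT => nVx.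
  by have : (A `\` V) x by []; rewrite AV0.
have [|x [Ax clx]] := Aco F FF; first by exists set0 => // x [].
have [V PV Vx] := cov x Ax.
have [|y [[_ nVy] Vy]] := clx (A `\` V) V _ Vx; first by exists V.
exact: nVy.
Qed.

Lemma closure_sub_closed (T : topologicalType) (A B : set T) :
  closed B -> A `<=` B -> closure A `<=` B.
Proof. by move=> cB AB; rewrite closureE; exact: smallest_sub. Qed.

Lemma clopen_between (T : topologicalType) (A W : set T) :
  has_clopen_basis T -> compact A -> open W -> A `<=` W ->
  exists U, [/\ clopen U, A `<=` U & U `<=` W].
Proof.
move=> [B Bclopen [_ Bbasis]] Aco oW AW.
have [||x Ax|U [cU UW] AU] :=
  @compact_directed_cover T A [set U | clopen U /\ U `<=` W] Aco.
- by split; [exact: clopen0|move=> x].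
- move=> U V [cU UW] [cV VW]; split; first exact: clopenU.
  by move=> x [/UW|/VW].
- have [V [BV Vx] VW] := Bbasis x W (open_nbhs_nbhs (conj oW (AW x Ax))).
  exists V; first by split=> //; exact: Bclopen.
  by apply: open_nbhs_nbhs; split=> //; case: (Bclopen V BV).
- by exists U.
Qed.

(** The index type has no decidable equality here: continuity of projections
    comes directly from the description of the product topology as a
    supremum. *)
Lemma prod_proj_cts (I : Type) (T : I -> topologicalType) (i : I) :
  continuous (fun u : prod_topology T => u i).
Proof.
move=> u; have /cvg_sup/(_ i) uu : u --> u by exact: cvg_id.
move=> A Aui; apply: uu.
exact: (@initial_continuous _ _ (fun f : (forall i, T i) => f i) u A Aui).
Qed.

Lemma prod_cts (I : Type) (T : I -> topologicalType) (S : topologicalType)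
    (f : S -> prod_topology T) :
  (forall i, continuous (fun s => f s i)) -> continuous f.
Proof.
move=> fi s; apply/cvg_sup => i A /=.
rewrite (@nbhsE (initial_topology (fun u : forall i, T i => u i))).
move=> [_ [[B oB <-] Bfs] sBA].
apply: (@filterS _ (nbhs s)) (fi i s B (open_nbhs_nbhs (conj oB Bfs))).
by move=> t; exact: sBA.
Qed.

Lemma gact_cts (G : topologicalGroupType) (X : flowType G) (g : G) :
  continuous (gact g : X -> X).
Proof.
move=> x; apply: (@continuous_comp _ _ _ (fun x => (g, x))
  (fun p : G * X => gact p.1 p.2)).
  by apply: cvg_pair; [exact: cvg_cst|exact: cvg_id].
exact: gact_continuous.
Qed.

Lemma gact_cts_l (G : topologicalGroupType) (X : flowType G) (x : X) :
  continuous (fun g : G => gact g x).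
Proof.
move=> g; apply: (@continuous_comp _ _ _ (fun g => (g, x))
  (fun p : G * X => gact p.1 p.2)).
  by apply: cvg_pair; [exact: cvg_id|exact: cvg_cst].
exact: gact_continuous.
Qed.

(** * Invariant clopen partitions and profiniteness *)

Section InvariantPartition.
Context (G : topologicalGroupType).

(** A finite quotient flow of [Y], given by the map that sends each point to its
    cell. *)
Record invariant_partition (Y : flowType G) := InvariantPartition {
  cell :> Y -> set Y;
  cell_refl : forall y, cell y y;
  cell_eq : forall y z, cell y z -> cell z = cell y;
  cell_act : forall (g : G) y z, cell y z -> cell (gact g y) (gact g z);
  cell_open : forall y, open (cell y);
  cell_finite : finite_set (range cell)
}.

Context (Y : flowType G).
Implicit Types r s : invariant_partition Y.

Definition cells r : Type := {A : set Y | `[< range r A >]}.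

HB.instance Definition _ r := Choice.on (cells r).
HB.instance Definition _ r := hasNbhs.Build (cells r) principal_filter.
HB.instance Definition _ r := Discrete_ofNbhs.Build (cells r) erefl.

Definition to_cell r (y : Y) : cells r :=
  exist (fun A => `[< range r A >]) (r y) (introT (asboolP _) (imageT r y)).

Lemma to_cellP r (A : cells r) : exists y, to_cell r y = A.
Proof.
by case: A => A rA; have [y _ ryA] := asboolP _ rA; exists y; apply/val_inj.
Qed.

Definition cell_rep r (A : cells r) : Y := sval (cid (to_cellP A)).

Lemma cell_repK r : cancel (@cell_rep r) (@to_cell r).
Proof. by move=> A; exact: (svalP (cid (to_cellP A))). Qed.

Lemma eq_to_cell r y z : (to_cell r y = to_cell r z) <-> r y z.
Proof.
split=> [[->]|/cell_eq ryz]; first exact: cell_refl.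
by apply/val_inj => /=; rewrite ryz.
Qed.

Lemma to_cell_cts r : continuous (to_cell r).
Proof.
move=> y A /principal_filterP Ay.
apply: filterS (open_nbhs_nbhs (conj (cell_open r y) (cell_refl r y))).
by move=> z /eq_to_cell ryz; rewrite /= -ryz.
Qed.

Lemma finite_cells r : finite_set [set: cells r].
Proof.
have : finite_set (val @^-1` range r : set (cells r)).
  apply: finite_preimage (cell_finite r).
  by move=> A B _ _; exact: val_inj.
apply: sub_finite_set => A _ /=; exact/asboolP/(valP A).
Qed.

Definition cells_act r (g : G) (A : cells r) : cells r :=
  to_cell r (gact g (cell_rep A)).

Lemma cells_actE r (g : G) y :
  cells_act g (to_cell r y) = to_cell r (gact g y).
Proof.
by apply/eq_to_cell/cell_act/eq_to_cell; rewrite cell_repK.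
Qed.

Lemma cells_act1 r (A : cells r) : cells_act 1%g A = A.
Proof. by case: (to_cellP A) => y <-; rewrite cells_actE gact1. Qed.

Lemma cells_actM r (g h : G) (A : cells r) :
  cells_act (g * h)%g A = cells_act g (cells_act h A).
Proof. by case: (to_cellP A) => y <-; rewrite !cells_actE gactM. Qed.

(** The topology of [G] enters here: for a fixed point [y], the set of [h] such
    that [h y] stays in the cell of [g y] is open, because cells are. *)
Lemma cells_act_cts r :
  continuous (fun p : G * cells r => cells_act p.1 p.2).
Proof.
move=> [g A] B /principal_filterP /= BgA.
exists ((fun h => to_cell r (gact h (cell_rep A))) @^-1` B, [set A]) => /=.
  split; last exact/principal_filterP.
  apply: (@continuous_comp _ _ _ (fun h => gact h (cell_rep A)) (to_cell r)).
  - exact: gact_cts_l.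
  - exact: to_cell_cts.
  - exact/principal_filterP.
by move=> [h C] [/= Bh ->].
Qed.

HB.instance Definition _ r := isFlow.Build G (cells r)
  (@cells_act1 r) (@cells_actM r) (@cells_act_cts r)
  (finite_compact (finite_cells r)) discrete_hausdorff.

Lemma to_cell_morphism r : flow_morphism (to_cell r).
Proof.
by split=> [|g y]; [exact: to_cell_cts|exact/esym/cells_actE].
Qed.

(** The order of the inverse system: later partitions are finer. *)
Definition finer r s : Prop := forall y, s y `<=` r y.

Lemma finer_refl r : finer r r. Proof. by move=> y z. Qed.

Lemma finer_trans r s t : finer r s -> finer s t -> finer r t.
Proof. by move=> rs st y; exact: subset_trans (st y) (rs y). Qed.

Definition trivial_partition : invariant_partition Y.
Proof.
apply: (@InvariantPartition Y (fun=> setT)) => // [y|]; first exact: openT.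
by apply: sub_finite_set (finite_set1 [set: Y]) => _ [y _ <-].
Defined.

Definition common_refinement r s : invariant_partition Y.
Proof.
apply: (@InvariantPartition Y (fun y => r y `&` s y)).
- by move=> y; split; exact: cell_refl.
- by move=> y z [/cell_eq -> /cell_eq ->].
- by move=> g y z [ry sy]; split; exact: cell_act.
- by move=> y; apply: openI; exact: cell_open.
- have := finite_image2 (fun A B => A `&` B) (cell_finite r) (cell_finite s).
  apply: sub_finite_set => _ [y _ <-] /=.
  by exists (r y); [exists y|exists (s y); [exists y|]].
Defined.

Lemma finer_directed r s : exists t, finer r t /\ finer s t.
Proof. by exists (common_refinement r s); split=> y z []. Qed.

Definition partition_directed : directedSet :=
  @DirectedSet (invariant_partition Y) finer finer_refl finer_trans
    (inhabits trivial_partition) finer_directed.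

Definition cells_map r s (rs : finer r s) (A : cells s) : cells r :=
  to_cell r (cell_rep A).

Lemma cells_mapE r s (rs : finer r s) y :
  cells_map rs (to_cell s y) = to_cell r y.
Proof.
apply/esym/eq_to_cell/rs/eq_to_cell; by rewrite cell_repK.
Qed.

Lemma cells_map_morphism r s (rs : finer r s) : flow_morphism (cells_map rs).
Proof.
split=> [A B /principal_filterP BA|g A]; first exact/principal_filterP.
case: (to_cellP A) => y <-.
by rewrite cells_mapE -2!(to_cell_morphism _).2 cells_mapE.
Qed.

Lemma cells_map_id r (rr : finer r r) (A : cells r) : cells_map rr A = A.
Proof. by case: (to_cellP A) => y <-; rewrite cells_mapE. Qed.

Lemma cells_map_comp r s t (rs : finer r s) (st : finer s t) (rt : finer r t)
  (A : cells t) : cells_map rs (cells_map st A) = cells_map rt A.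
Proof. by case: (to_cellP A) => y <-; rewrite !cells_mapE. Qed.

Definition partition_system : inverse_system :=
  @InverseSystem G partition_directed (fun r => cells r : flowType G)
    cells_map cells_map_morphism cells_map_id cells_map_comp.

(** Separation makes the canonical map into the product injective and makes the
    topology of [Y] the induced one. Surjectivity onto the threads is
    compactness: a thread is a downward directed family of nonempty closed
    cells, so that these cannot have empty intersection. *)
Lemma profinite_of_partitions :
  (forall (y : Y) (W : set Y), open W -> W y ->
     exists r : invariant_partition Y, r y `<=` W) ->
  profinite_flow Y.
Proof.
move=> sep; exists partition_system; first by move=> r; exact: finite_cells.
exists to_cell => phi; split.
- exact: to_cell_morphism.
- move=> y z yz; apply: contrapT => ynz.
  have cz : closed [set z].
    exact/accessible_closed_set1/hausdorff_accessible/flow_hausdorff.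
  have [r] := sep y (~` [set z]) (closed_openC cz) ynz.
  move/(_ z); apply => //; apply/eq_to_cell.
  exact: (congr1 (fun u => u r) yz).
- apply/seteqP; split=> [_ [y _ <-] r s rs|A thA]; first exact: cells_mapE.
  have [y yA] : exists y, forall r, to_cell r y = A r.
    apply: contrapT => noy.
    have [|V W|y _|V [r VA] YV] := @compact_directed_cover Y setT
      [set V | exists r, V `<=` [set y | to_cell r y <> A r]] flow_compact.
    + by exists trivial_partition.
    + move=> [r Vr] [s Ws]; exists (common_refinement r s).
      have rt : finer r (common_refinement r s) by move=> y z [].
      have st : finer s (common_refinement r s) by move=> y z [].
      move=> y VWy /= yA; case: VWy => [/Vr|/Ws]; apply.
        by rewrite -(thA _ _ rt) -yA; exact/esym/cells_mapE.
      by rewrite -(thA _ _ st) -yA; exact/esym/cells_mapE.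
    + have [r ry] : exists r, to_cell r y <> A r.
        apply: contrapT => nr; apply: noy; exists y => r.
        by apply: contrapT => ry; apply: nr; exists r.
      exists (r y).
        by exists r => z /eq_to_cell ryz; rewrite /= -ryz.
      by apply: open_nbhs_nbhs; split; [exact: cell_open|exact: cell_refl].
    + case: (to_cellP (A r)) => y yA; exact: (VA y (YV y _)).
  exists y => //; exact: functional_extensionality_dep yA.
- apply/seteqP; split=> [W oW|W [B oB <-]]; last first.
    apply: open_comp oB => y _; apply: prod_cts => r; exact: to_cell_cts.
  (* [W] is the union of the cells that it contains. *)
  pose inW r : set (cells r) := [set A | val A `<=` W].
  exists (\bigcup_r
    (fun u : prod_topology (fun r => cells r) => u r) @^-1` inW r).
    apply: bigcup_open => r _; apply: open_comp => [u _|].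
      exact: prod_proj_cts.
    by rewrite openE => A WA; exact/principal_filterP.
  apply/seteqP; split=> [y [r _]|y Wy]; first by apply; exact: cell_refl.
  by have [r rW] := sep y W oW Wy; exists r.
Qed.

End InvariantPartition.

(** * Orbit closures of a normal subgroup of finite index *)

Section FiniteIndexCells.
Context (G : topologicalGroupType) (Y : flowType G) (N : set G) (D : set G).
Hypothesis Y_minimal : minimal_flow Y.
Hypothesis N1 : N 1%g.
Hypothesis NM : forall g h, N g -> N h -> N (g * h)%g.
Hypothesis NJ : forall g h, N g -> N (h * g * h^-1)%g.
Hypothesis NX : forall g, exists2 m, (0 < m)%N & N (g ^+ m)%g.
Hypothesis D_finite : finite_set D.
Hypothesis DN : forall g, exists2 d, D d & N (d^-1 * g)%g.

Definition orbit_closure (y : Y) : set Y := closure [set gact n y | n in N].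

Local Notation C := orbit_closure.

Lemma orbit_closure_refl y : C y y.
Proof. by apply: subset_closure; exists 1%g; rewrite ?gact1. Qed.

Lemma orbit_closure_N y n : N n -> C y (gact n y).
Proof. by move=> Nn; apply: subset_closure; exists n. Qed.

Lemma orbit_closure_act g y z : C y z -> C (gact g y) (gact g z).
Proof.
have : C y `<=` gact g @^-1` C (gact g y).
  apply: closure_sub_closed => [|_ [n Nn <-]].
    apply: preimage_closed; first by move=> x _; exact: gact_cts.
    exact: closed_closure.
  apply: subset_closure; exists (g * n * g^-1)%g; first exact: NJ.
  by rewrite -!gactM -!mulgA mulVg mulg1.
by apply.
Qed.

Lemma orbit_closure_trans y z t : C y z -> C z t -> C y t.
Proof.
move=> yz; suff : C z `<=` C y by apply.
apply: closure_sub_closed; first exact: closed_closure.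
move=> _ [n Nn <-]; have : C y `<=` gact n @^-1` C y; last by apply.
apply: closure_sub_closed => [|_ [n' Nn' <-]].
  apply: preimage_closed; first by move=> x _; exact: gact_cts.
  exact: closed_closure.
by rewrite /= -gactM; apply: orbit_closure_N; exact: NM.
Qed.

(** The finitely many translates of an [N]-orbit closure by coset
    representatives form a closed [G]-invariant set. *)
Lemma orbit_closure_cover y z : exists2 d, D d & C (gact d y) z.
Proof.
have [_ min] := Y_minimal.
have : (\bigcup_(d in D) C (gact d y)) z; last by case=> d; exists d.
suff -> : \bigcup_(d in D) C (gact d y) = setT by [].
apply: min.
- by apply: closed_bigcup => // d _; exact: closed_closure.
- have [d Dd _] := DN 1%g; exists (gact d y), d => //.
  exact: orbit_closure_refl.
- move=> g x [d Dd Cx]; have [e De Nn] := DN (g * d)%g; exists e => //.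
  refine (orbit_closure_trans _ (orbit_closure_act (g := g) Cx)).
  have := orbit_closure_act (g := e) (orbit_closure_N (y:=y) Nn).
  by rewrite -!gactM mulgA mulgV mul1g.
Qed.

(** Write [z <= y] for [C y z], a [G]-invariant preorder. From [y <= d y]
    follows [d y <= d ^ 2 y <= ...], and a power of [d] lies in [N], which
    closes the cycle: [d y <= d ^ m y <= y]. This replaces the choice of a
    minimal closed [N]-invariant set. *)
Lemma orbit_closure_recurrent d y : C (gact d y) y -> C y (gact d y).
Proof.
move=> Cdy; have [[//|m] _ Nm] := NX d.
suff H k : C (gact (d ^+ k.+1)%g y) (gact d y).
  exact: orbit_closure_trans (orbit_closure_N (y:=y) Nm) (H m).
elim: k => [|k IHk]; first by rewrite expg1; exact: orbit_closure_refl.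
refine (orbit_closure_trans _ IHk).
by rewrite expgSr gactM; exact: orbit_closure_act.
Qed.

(** For [z <= y], some [d] has [y <= d z]. Hence [z <= y <= d z], so that
    [d z <= z] by [orbit_closure_recurrent], and therefore [y <= z]. *)
Lemma orbit_closure_sym y z : C y z -> C z y.
Proof.
move=> yz; have [d Dd dzy] := orbit_closure_cover z y.
refine (orbit_closure_trans _ dzy); apply: orbit_closure_recurrent.
exact: orbit_closure_trans dzy yz.
Qed.

Lemma orbit_closure_eq y z : C y z -> C z = C y.
Proof.
move=> yz; apply/seteqP; split=> t; first exact: orbit_closure_trans.
by apply: orbit_closure_trans; exact: orbit_closure_sym.
Qed.

Lemma orbit_closure_finite : finite_set (range C).
Proof.
have [[y _] _] := Y_minimal.
apply: sub_finite_set (finite_image (fun d => C (gact d y)) D_finite).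
move=> _ [z _ <-]; have [d Dd dyz] := orbit_closure_cover y z.
by exists d => //; exact/esym/orbit_closure_eq.
Qed.

(** Cells are closed, disjoint and finite in number, so that each is the
    complement of a closed set. *)
Lemma orbit_closure_open y : open (C y).
Proof.
rewrite -[C y]setCK; apply: closed_openC.
have -> : ~` C y = \bigcup_(B in range C `\` [set C y]) B.
  apply/seteqP; split=> [z nz|z [_ [[t _ <-] nt] tz] yz].
    exists (C z); last exact: orbit_closure_refl.
    split; first by exists z.
    by move=> zy; apply: nz; rewrite -zy; exact: orbit_closure_refl.
  by apply: nt => /=; rewrite -(orbit_closure_eq tz) (orbit_closure_eq yz).
apply: closed_bigcup; first exact/finite_setD/orbit_closure_finite.
by move=> _ [[z _ <-] _]; exact: closed_closure.
Qed.

Definition orbit_closure_partition : invariant_partition Y :=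
  InvariantPartition orbit_closure_refl orbit_closure_eq orbit_closure_act
    orbit_closure_open orbit_closure_finite.

End FiniteIndexCells.

(** * Correspondences from a group to a finite group *)

Section FiniteCorrespondence.
Context (G : groupType) (P : finGroupType) (R : G -> P -> Prop).
Hypothesis RM : forall g h s t, R g s -> R h t -> R (g * h)%g (s * t)%g.
Hypothesis R_total : forall g, exists s, R g s.

Definition correspondence_kernel : set G := [set g | R g 1%g].
Local Notation N := correspondence_kernel.

(** A multiplicative relation between a group and a finite group that is total
    on the left is a subgroup of the product: a nonempty subset of a finite
    group that is closed under products is a subgroup, and elements of [G] have
    partners for their inverses by totality. *)
Lemma correspondence1 : R 1%g 1%g.
Proof.
have [s Rs] := R_total 1%g.
suff R1 n : R 1%g (s ^+ n.+1)%g.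
  by rewrite -(expg_order s) -(prednK (order_gt0 s)).
elim: n => [|n IHn]; first by rewrite expg1.
by rewrite expgS -{1}(mulg1 1%g); exact: RM.
Qed.

Lemma correspondenceX g s n : R g s -> R (g ^+ n)%g (s ^+ n)%g.
Proof.
move=> Rgs; elim: n => [|n IHn].
  by rewrite !expg0; exact: correspondence1.
by rewrite !expgS; exact: RM.
Qed.

(** With [t] a partner of [g^-1] and [m] the order of [s t], the element
    [(s t) ^ (m - 1)] is a partner of [1], and its product with [t], a partner
    of [g^-1], is [s^-1]. *)
Lemma correspondenceV g s : R g s -> R g^-1%g s^-1%g.
Proof.
move=> Rgs; have [t Rt] := R_total g^-1%g.
have := correspondenceX #[s * t]%g.-1 (RM Rgs Rt).
rewrite mulgV expg1n => /(RM Rt); rewrite mulg1.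
suff -> : (t * (s * t) ^+ #[s * t].-1 = s^-1)%g by [].
apply: (mulgI s); rewrite mulgA -expgS (prednK (order_gt0 _)) expg_order.
by rewrite mulgV.
Qed.

Lemma correspondence_kernelM g h : N g -> N h -> N (g * h)%g.
Proof. by move=> Ng Nh; rewrite /N /= -(mulg1 1%g); exact: RM. Qed.

Lemma correspondence_kernelJ g h : N g -> N (h * g * h^-1)%g.
Proof.
move=> Ng; have [s Rhs] := R_total h.
rewrite /N /= -(mulgV s) -{1}(mulg1 s).
by apply: RM; [exact: RM|exact: correspondenceV].
Qed.

Lemma correspondence_kernelX g : exists2 m, (0 < m)%N & N (g ^+ m)%g.
Proof.
have [s Rgs] := R_total g.
exists #[s]%g => //.
by rewrite /N /= -(expg_order s); exact: correspondenceX.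
Qed.

(** Two elements of [G] with a common partner differ by an element of the
    kernel, so that one representative for each partner suffices. *)
Lemma correspondence_kernel_index :
  exists2 D : set G, finite_set D &
    forall g, exists2 d, D d & N (d^-1 * g)%g.
Proof.
pose c (s : P) : G := xget 1%g [set g | R g s].
exists (range c); first by apply: finite_image; exact: finite_finset.
move=> g; have [s Rgs] := R_total g; exists (c s); first by exists s.
rewrite /N /= -(mulVg s); apply: RM => //; apply: correspondenceV.
by apply: (@xgetPex _ 1%g [set g | R g s]); exists g.
Qed.

End FiniteCorrespondence.

(** * Idempotents in compact semigroups *)

Section Ellis.
Context (T : topologicalType) (mul : T -> T -> T).
Hypothesis mulA : forall x y z, mul x (mul y z) = mul (mul x y) z.
Hypothesis mul_cts : forall s, continuous (fun x => mul x s).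
Hypothesis T_hausdorff : hausdorff_space T.

Let compact_subsemigroup (S : set T) : Prop :=
  [/\ compact S, S !=set0 & forall x y, S x -> S y -> S (mul x y)].

(** Zorn's lemma for unions, applied to the complements in [L]: a chain of
    nonempty closed subsets of a compact set has nonempty intersection. *)
Lemma minimal_compact_subsemigroup (L : set T) : compact_subsemigroup L ->
  exists S, [/\ compact_subsemigroup S, S `<=` L &
    forall S', compact_subsemigroup S' -> S' `<=` S -> S `<=` S'].
Proof.
move=> [Lco L0 LM].
pose P A := compact_subsemigroup (L `\` A).
have [F FP Ftot|A [PA Amax]] := @Zorn_bigcup T P; last first.
  exists (L `\` A); split; [exact: PA|by move=> x []|].
  move=> S' S'P S'sub x [Lx nAx]; apply: contrapT => nS'x.
  apply: (Amax (~` S')).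
    split; first by move=> y Ay /S'sub[].
    by move=> /(_ x nS'x).
  rewrite /P (_ : L `\` ~` S' = S') //.
  apply/seteqP; split=> y; first by case=> _ /contrapT.
  by move=> S'y; split; [case: (S'sub y S'y)|apply].
have cl A : F A -> closed (L `\` A).
  by move=> FA; apply: compact_closed => //; case: (FP A FA).
split.
- have [[A FA]|noA] := pselect (exists A, F A); last first.
    rewrite (_ : \bigcup_(X in F) X = set0) ?setD0 //.
    by rewrite -subset0 => x [A FA _]; apply: noA; exists A.
  apply: (subclosed_compact _ Lco); last by move=> x [].
  have -> : L `\` \bigcup_(X in F) X = \bigcap_(X in F) (L `\` X).
    apply/seteqP; split=> [x [Lx nx] B FB|x nx].
      by split=> // Bx; apply: nx; exists B.
    split; first by case: (nx A FA).
    by move=> [B FB Bx]; case: (nx B FB).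
  exact: closed_bigI.
- apply: contrapT => /set0P/negP; rewrite negbK => /eqP LF0.
  have [|V W|x Lx|V [->|[A FA VA]]] :=
    @compact_directed_cover T L
      [set V | V = set0 \/ exists2 A, F A & V `&` L `<=` A] Lco.
  + by left.
  + move=> [->|[A FA VA]] [->|[B FB WB]]; rewrite ?setU0 ?set0U;
      [by left|right..].
    * by exists B.
    * by exists A.
    * have [AB|BA] := Ftot A B FA FB.
        exists B => // y [[Vy|Wy] Ly]; [apply/AB/VA|exact: WB]; by [].
      exists A => // y [[Vy|Wy] Ly]; [exact: VA|apply/BA/WB]; by [].
  + have [A FA Ax] : exists2 A, F A & A x.
      apply: contrapT => nA; have : (L `\` \bigcup_(X in F) X) x.
        by split=> // -[A FA Ax]; apply: nA; exists A.
      by rewrite LF0.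
    exists (~` (L `\` A)); last first.
      apply: open_nbhs_nbhs; split; first exact/closed_openC/cl.
      by case.
    right; exists A => // y [nLA Ly]; apply: contrapT => nAy; exact: nLA.
  + by move=> L00; case: L0 => x /L00.
  + move=> LV; case: (FP A FA) => _ [x [Lx nAx]] _.
    by apply/nAx/VA; split=> //; apply: LV.
- move=> x y [Lx nx] [Ly ny]; split; first exact: LM.
  move=> [A FA Axy]; case: (FP A FA) => _ _ /(_ x y)[].
  + by split=> // Ax; apply: nx; exists A.
  + by split=> // Ay; apply: ny; exists A.
  + by move=> _; apply.
Qed.

(** In a minimal compact subsemigroup [S], every [s] satisfies [S s = S]; so the
    compact subsemigroup of those [t] with [t s = s] is nonempty, hence is all
    of [S], and contains [s]. *)
Lemma ellis_numakura (L : set T) : compact L -> L !=set0 ->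
  (forall x y, L x -> L y -> L (mul x y)) ->
  exists2 e, L e & mul e e = e.
Proof.
move=> Lco L0 LM.
have [//|S [[Sco [s Ss] SM] SL Smin]] := @minimal_compact_subsemigroup L.
have SSs : S `<=` (mul^~ s) @` S.
  apply: Smin; last by move=> _ [x Sx <-]; exact: SM.
  split.
  - apply: continuous_compact => //.
    by apply: continuous_subspaceT => x; apply: mul_cts.
  - by exists (mul s s), s.
  - move=> _ _ [x Sx <-] [y Sy <-].
    exists (mul (mul x s) y); last by rewrite mulA.
    exact: (SM _ _ (SM _ _ Sx Ss) Sy).
exists s; first exact: SL.
suff : S `<=` S `&` [set t | mul t s = s] by move=> /(_ s Ss)[].
apply: Smin; last by move=> x [].
split.
- apply: compact_closedI => //.
  have -> : [set t | mul t s = s] = (mul^~ s) @^-1` [set s] by [].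
  apply: preimage_closed; first by move=> x _; exact: mul_cts.
  exact/accessible_closed_set1/hausdorff_accessible.
- by have [t St ts] := SSs s Ss; exists t.
- by move=> x y [Sx xs] [Sy ys]; split; [exact: SM|rewrite /= -mulA ys xs].
Qed.

End Ellis.

(** * The Ellis semigroup of a flow *)

Section EllisSemigroup.
Context (G : topologicalGroupType) (X : flowType G).
Implicit Types (g : G) (xi zeta eta : {ptws X -> X}).

Definition ellis : set {ptws X -> X} :=
  closure (range (fun g => gact g : {ptws X -> X})).

Lemma ellis_gact g : ellis (gact g).
Proof. by apply: subset_closure; exists g. Qed.

Lemma ellis_approx xi (V : set {ptws X -> X}) :
  ellis xi -> nbhs xi V -> exists g, V (gact g).
Proof. by move=> Exi /Exi[_ [[g _ <-] Vg]]; exists g. Qed.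

Lemma precomp_cts zeta :
  continuous (fun xi : {ptws X -> X} => xi \o zeta : {ptws X -> X}).
Proof.
by apply: prod_cts => x; exact: (@prod_proj_cts X (fun=> X) (zeta x)).
Qed.

Lemma gact_eval_cts g x :
  continuous (fun xi : {ptws X -> X} => gact g (xi x)).
Proof.
move=> xi; apply: (@continuous_comp _ _ _ (fun xi : {ptws X -> X} => xi x)).
  exact: (@prod_proj_cts X (fun=> X) x).
exact: gact_cts.
Qed.

(** In general only right multiplications are continuous on the whole of
    [X ^ X], so that closedness is used twice: for left multiplications by
    elements of [G] and then for right multiplications by elements of the
    closure. *)
Lemma ellis_comp xi zeta : ellis xi -> ellis zeta ->
  ellis (xi \o zeta : {ptws X -> X}).
Proof.
move=> Exi Ezeta; suff : ellis `<=`
    (fun xi => xi \o zeta : {ptws X -> X}) @^-1` ellis by apply.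
apply: closure_sub_closed => [|_ [g _ <-]].
  apply: preimage_closed; first by move=> u _; exact: precomp_cts.
  exact: closed_closure.
suff : ellis `<=` (fun zeta => gact g \o zeta : {ptws X -> X}) @^-1` ellis.
  exact.
apply: closure_sub_closed => [|_ [h _ <-]].
  apply: preimage_closed; last exact: closed_closure.
  by move=> u _; apply: prod_cts => x; exact: gact_eval_cts.
rewrite /= (_ : _ \o _ = gact (g * h)%g); first exact: ellis_gact.
by apply/funext => x; rewrite gactM.
Qed.

Lemma ptws_hausdorff : hausdorff_space {ptws X -> X}.
Proof. exact: (@hausdorff_product X (fun=> X) (fun=> flow_hausdorff)). Qed.

Lemma ellis_compact : compact ellis.
Proof.
apply: (@subclosed_compact _ ellis setT) => //; first exact: closed_closure.
have := @tychonoff X (fun=> X) (fun=> setT) (fun=> flow_compact).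
by congr compact; apply/seteqP; split.
Qed.

Lemma ellis_left_ideal_idempotent eta : ellis eta ->
  exists2 zeta, ellis zeta &
    (zeta \o eta) \o (zeta \o eta) = zeta \o eta.
Proof.
move=> Eeta.
have [||_ _ [xi Exi <-] [zeta Ezeta <-]|_ [zeta Ez <-] idem] :=
  @ellis_numakura {ptws X -> X} (fun u v => u \o v) (fun _ _ _ => erefl)
    precomp_cts ptws_hausdorff
    ((fun xi => xi \o eta : {ptws X -> X}) @` ellis).
- apply: continuous_compact ellis_compact.
  by apply: continuous_subspaceT => u; exact: precomp_cts.
- exists eta, (gact 1%g); first exact: ellis_gact.
  by apply/funext => x; exact: gact1.
- exists (xi \o eta \o zeta) => //.
  by apply: ellis_comp => //; exact: ellis_comp.
- by exists zeta.
Qed.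

End EllisSemigroup.

(** The directed set that turns membership in a closure into a convergent
    net. *)
Definition nbhs_directed (T : topologicalType) (t : T) : directedSet.
Proof.
apply: (@DirectedSet {V : set T | nbhs t V} (fun V W => sval W `<=` sval V)).
- by move=> V x.
- by move=> V W Z VW WZ x /WZ/VW.
- by exists; exists setT; exact: filterT.
- move=> [V tV] [W tW]; exists (exist _ (V `&` W) (filterI tV tW)).
  by split=> x [].
Defined.

Section DistalFactor.
Context (G : topologicalGroupType) (X Y : flowType G) (f : X -> Y).
Hypothesis f_morphism : flow_morphism f.

Let f_act g x : f (gact g x) = gact g (f x).
Proof. exact: f_morphism.2. Qed.

(** A net of [G] converging to [eps] moves [f x] and [f (eps x)] to the same
    limit [f (eps x) = f (eps (eps x))]. *)
Lemma distal_factor_idempotent (eps : {ptws X -> X}) : distal Y ->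
  ellis eps -> eps \o eps = eps -> f \o eps = f.
Proof.
move=> Y_distal Eeps idem; apply/funext => x; apply: contrapT => neq.
apply: (Y_distal _ _ neq).
have [v vP] := choice (fun V : nbhs_directed eps =>
  ellis_approx Eeps (svalP V)).
have v_cvg (h : {ptws X -> X} -> Y) : continuous h ->
    h (gact (v V)) @[V --> tails (nbhs_directed eps)] --> h eps.
  move=> h_cts O /h_cts hO.
  exists (exist (fun V => nbhs eps V) (h @^-1` O) hO) => // W WV.
  by apply: WV; exact: vP.
have eval_cts z : continuous (fun xi : {ptws X -> X} => f (xi z)).
  move=> xi; apply: (@continuous_comp _ _ _ (fun xi : {ptws X -> X} => xi z)).
    exact: (@prod_proj_cts X (fun=> X) z).
  exact: f_morphism.1.
have netE z : (fun V => gact (v V) (f z)) = (fun V => f (gact (v V) z)).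
  by apply/funext => V; rewrite f_act.
have idem_x : f (eps (eps x)) = f (eps x).
  by rewrite -[in RHS]idem.
exists (nbhs_directed eps), v, (f (eps x)); rewrite !netE; split.
  by rewrite -[X in _ --> X]idem_x; exact: v_cvg (eval_cts (eps x)).
exact: v_cvg (eval_cts x).
Qed.

End DistalFactor.

(** * Traces of a clopen set under the Ellis semigroup *)

Section Traces.
Context (G : topologicalGroupType) (X : flowType G) (U : set X).
Hypothesis U_clopen : clopen U.
Implicit Types (g h : G) (xi zeta eta : {ptws X -> X}).

Definition traces eta : set (set X) :=
  [set (xi \o eta) @^-1` U | xi in @ellis G X].

(** The coloring of [A] that sends [a] to the set of those [x] in [F] for which
    [a (eta x)] lies in [U] takes at most [l] values, which are here
    numbered. *)
Definition few_colors (l : nat) (F : {fset X}) (A : {fset G}) eta : Prop :=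
  exists k : G -> nat, {in A, forall a, k a < l} /\
    {in A &, forall a b, k a = k b ->
      {in F, forall x, U (gact a (eta x)) <-> U (gact b (eta x))}}.

(** The coloring given by the points of [F] and by the single set [U] tests, at
    [h a^-1], whether [x] lies in [h a^-1 U], that is, whether [a (h^-1 x)] lies
    in [U]. So the hypothesis is applied to the set of inverses of elements of
    [A], and [g] is [h^-1]. *)
Lemma EDRdeg_few_colors (x0 : X) : sep_fin_EDRdeg X ->
  exists l, forall F A, exists g, few_colors l F A (gact g).
Proof.
move=> /(_ [set U] (finite_set1 U))[|l l_gt0 lP]; first by move=> _ ->.
exists l => F A.
(* [x0] and [1] are added because the sets must not be empty. *)
pose F' := (x0 |` F)%fset; pose A' := [fset a^-1 | a in 1 |` A]%g%fset.
pose c g := [ffun i : 'I_#|`F'| => `[< (gact g @` U) (nth x0 F' i) >]].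
have F'_gt0 : 0 < #|`F'|.
  by rewrite cardfs_gt0; apply/fset0Pn; exists x0; rewrite fset1U1.
have A'_gt0 : 0 < #|`A'|.
  rewrite cardfs_gt0; apply/fset0Pn; exists 1^-1%g.
  by apply/in_imfset; rewrite /= fset1U1.
have c_def : ext_definable_coloring [set U] c.
  exists (fun=> U), (fun i => nth x0 F' i); split=> // g i.
  by rewrite ffunE.
have [h hl] := lP _ c F'_gt0 c_def _ A' A'_gt0 erefl.
pose values := [fset c (h * a)%g | a in A']%fset.
exists h^-1%g, (fun a => index (c (h * a^-1)%g) values).
have memc a : a \in A -> c (h * a^-1)%g \in values.
  move=> aA; apply/imfsetP; exists a^-1%g => //=.
  by apply: in_imfset; rewrite /= fset1Ur.
split=> [a /memc|a b /memc aA /memc bA /(congr1 (nth (c 1%g) values))].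
  by rewrite -index_mem => /leq_trans; apply.
rewrite !nth_index // => cab x xF.
have xF' : x \in F' by rewrite fset1Ur.
have i_lt : index x F' < #|`F'| by rewrite index_mem.
have := congr1 (fun u : {ffun _ -> _} => u (Ordinal i_lt)) cab.
have gU (g : G) : (gact (h * g^-1)%g @` U) x <-> U (gact g (gact h^-1%g x)).
  rewrite -gactM; split=> [[z Uz <-]|Ux].
    by rewrite -gactM -!mulgA mulKg mulgV gact1.
  exists (gact (g * h^-1)%g x) => //.
  by rewrite -gactM mulgA mulgKV mulgV gact1.
rewrite !ffunE /= nth_index // => /(congr1 is_true).
by rewrite !asboolE => eqab; rewrite -!gU /= eqab.
Qed.

(** Only clopenness of [U] makes membership in [U] stable for maps that are
    pointwise close. *)
Lemma near_trace eta (A : {fset G}) (F : {fset X}) :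
  \forall xi \near eta, {in A, forall a, {in F, forall x,
    U (gact a (xi x)) <-> U (gact a (eta x))}}.
Proof.
have [oU cU] := U_clopen.
have near1 a x : \forall xi \near eta,
    U (gact a (xi x)) <-> U (gact a (eta x)).
  have [Ux|nUx] := pselect (U (gact a (eta x))).
    have : nbhs eta [set xi : {ptws X -> X} | U (gact a (xi x))].
      exact: (@gact_eval_cts G X a x eta _ (open_nbhs_nbhs (conj oU Ux))).
    by apply: filterS => xi ?; split.
  have : nbhs eta [set xi : {ptws X -> X} | ~ U (gact a (xi x))].
    exact: (@gact_eval_cts G X a x eta _
      (open_nbhs_nbhs (conj (closed_openC cU) nUx))).
  by apply: filterS => xi ?; split.
have nearA a : a \in A -> nbhs eta (\bigcap_(x in [set` F])
    [set xi : {ptws X -> X} | U (gact a (xi x)) <-> U (gact a (eta x))]).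
  by move=> _; apply: filter_bigI => x _; exact: near1.
have := filter_bigI (nbhs_filter eta) nearA.
by apply: filterS => xi H a aA x xF; exact: (H a aA x xF).
Qed.

(** The elements of [E] that work for a given pair [(F, A)] become fewer as the
    pair grows; a cluster point of the filter they generate works for all pairs
    by [near_trace]. *)
Lemma EDRdeg_ellis_few_colors (x0 : X) : sep_fin_EDRdeg X ->
  exists l, exists2 eta, @ellis G X eta & forall F A, few_colors l F A eta.
Proof.
move=> /(EDRdeg_few_colors x0)[l lP]; exists l.
pose Q (q : {fset X} * {fset G}) : set {ptws X -> X} :=
  [set xi | @ellis G X xi /\ few_colors l q.1 q.2 xi].
have QF : ProperFilter (filter_from setT Q).
  apply: filter_from_proper; last first.
    move=> q _; have [g gq] := lP q.1 q.2.
    by exists (gact g); split=> //; exact: ellis_gact.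
  apply: filter_from_filter; first by exists (fset0, fset0).
  move=> [F A] [F' A'] _ _; exists (F `|` F', A `|` A')%fset => //.
  move=> xi [Exi [k /= [kl kP]]]; split; split=> //; exists k; split=> /=.
  - by move=> a aA; apply: kl; rewrite in_fsetU aA.
  - move=> a b aA bA kab x xF; apply: kP => //; by rewrite in_fsetU ?aA ?bA ?xF.
  - by move=> a aA; apply: kl; rewrite in_fsetU aA orbT.
  - move=> a b aA bA kab x xF; apply: kP => //;
      by rewrite in_fsetU ?aA ?bA ?xF ?orbT.
have [|eta [Eeta cleta]] := @ellis_compact G X _ QF.
  by exists (fset0, fset0) => // xi [].
exists eta => // F A.
have [|xi [[_ [k [kl kP]]] near_xi]] :=
    cleta (Q (F, A)) _ _ (near_trace eta A F).
  by exists (F, A).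
exists k; split=> // a b aA bA kab x xF.
by rewrite -(near_xi a aA x xF) -(near_xi b bA x xF); exact: kP.
Qed.

(** Among [l + 1] distinct traces any two are separated by a point of some
    finite set [F]. On [F] each trace is also cut out by an element of [G], and
    these [l + 1] elements would need different colors. *)
Lemma few_colors_finite_traces (x0 : X) l eta :
  (forall F A, few_colors l F A eta) -> finite_set (traces eta).
Proof.
move=> few; apply: contrapT => /(infinite_set_fset l.+1)[B BT lB].
pose sep (S T : set X) : X := xget x0 [set x | ~ (S x <-> T x)].
have sepP S T : S <> T -> ~ (S (sep S T) <-> T (sep S T)).
  move=> ST; apply: (@xgetPex _ x0 [set x | ~ (S x <-> T x)]).
  apply: contrapT => nx; apply/ST/seteqP; split=> x.
    by move=> Sx; apply: contrapT => nTx; apply: nx; exists x => -[/(_ Sx)].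
  by move=> Tx; apply: contrapT => nSx; apply: nx; exists x => -[_ /(_ Tx)].
pose F := [fset sep S T | S in B, T in B]%fset.
have approx S : exists g, S \in B ->
    {in F, forall x, U (gact g (eta x)) <-> S x}.
  have [SB|_] := boolP (S \in B); last by exists 1%g.
  have [xi Exi <-] := BT S SB.
  have [g gxi] :=
    ellis_approx Exi (near_trace xi [fset 1%g]%fset (eta @` F)%fset).
  exists g => _ x xF; have := gxi 1%g (fset11 _) (eta x) (in_imfset _ _ xF).
  by rewrite !gact1.
have {approx}[g gP] := choice approx.
have [k [kl kP]] := few F (g @` B)%fset.
have : #|`B| <= l.
  rewrite -(size_iota 0 l) -(size_map (k \o g)); apply: uniq_leq_size.
    rewrite map_inj_in_uniq ?fset_uniq // => S T SB TB /= kST.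
    apply: contrapT => ST; apply: (sepP S T ST).
    have sF : sep S T \in F by apply: in_imfset2.
    rewrite -(gP S SB _ sF) -(gP T TB _ sF).
    by apply: kP => //; exact: in_imfset.
  by move=> _ /mapP[S SB ->]; rewrite mem_iota /=; apply/kl/in_imfset.
by rewrite leqNgt lB.
Qed.

Lemma EDRdeg_finite_traces (x0 : X) : sep_fin_EDRdeg X ->
  exists2 eta, @ellis G X eta & finite_set (traces eta).
Proof.
move=> /(EDRdeg_ellis_few_colors x0)[l [eta Eeta few]].
by exists eta => //; exact: few_colors_finite_traces few.
Qed.

End Traces.

Section TraceAction.
Context (G : topologicalGroupType) (X : flowType G) (U : set X).

Lemma traces_left (zeta eta : {ptws X -> X}) : ellis zeta ->
  traces U (zeta \o eta) `<=` traces U eta.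
Proof.
move=> Ezeta _ [xi Exi <-]; exists (xi \o zeta) => //; exact: ellis_comp.
Qed.

(** Right multiplication by [zeta] maps the traces of [eta] onto those of
    [eta \o zeta]: it cannot increase their number. *)
Lemma traces_comp (zeta eta : {ptws X -> X}) :
  traces U (eta \o zeta) = (fun S => zeta @^-1` S) @` traces U eta.
Proof.
apply/seteqP; split=> [_ [xi Exi <-]|_ [_ [xi Exi <-] <-]]; last by exists xi.
by exists ((xi \o eta) @^-1` U) => //; exists xi.
Qed.

(** Choose [eta] with the least number of traces; then [traces_comp] is a
    surjection between finite sets of the same cardinality. *)
Lemma minimal_traces (eta0 : {ptws X -> X}) :
  ellis eta0 -> finite_set (traces U eta0) ->
  exists eta : {ptws X -> X}, [/\ ellis eta, finite_set (traces U eta) &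
    forall zeta : {ptws X -> X}, ellis zeta ->
      {in traces U eta &, injective (fun S => zeta @^-1` S)}].
Proof.
move=> Eeta0 fin0.
pose P n := `[< exists eta : {ptws X -> X},
  [/\ ellis eta, finite_set (traces U eta) &
      #|`fset_set (traces U eta)| = n] >].
have exP : exists n, P n.
  by exists #|`fset_set (traces U eta0)|; apply/asboolP; exists eta0.
case: (ex_minnP exP) => n /asboolP[eta [Eeta fin cardn]] minn.
exists eta; split=> // zeta Ezeta.
have im_fin : finite_set (traces U (eta \o zeta)).
  by rewrite traces_comp; exact: finite_image.
have := minn #|`fset_set (traces U (eta \o zeta))|.
rewrite traces_comp fset_set_image // -cardn => le_card.
have inj : {in fset_set (traces U eta) &, injective (fun S => zeta @^-1` S)}.
  apply/card_in_imfsetP; rewrite eqn_leq leq_imfset_card /=.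
  apply: le_card; apply/asboolP; exists (eta \o zeta); split=> //.
    exact: ellis_comp.
  by rewrite traces_comp fset_set_image.
by move=> S T SU TU; apply: inj; rewrite in_fset_set.
Qed.

(** By [traces_left], every element of the left ideal [E eta], in particular an
    idempotent of it, inherits finiteness and injectivity from [eta]. *)
Lemma minimal_idempotent (x0 : X) : clopen U -> sep_fin_EDRdeg X ->
  exists eps : {ptws X -> X},
    [/\ ellis eps, eps \o eps = eps, finite_set (traces U eps) &
    forall zeta : {ptws X -> X}, ellis zeta ->
      {in traces U eps &, injective (fun S => zeta @^-1` S)}].
Proof.
move=> cU /(EDRdeg_finite_traces cU x0)[eta0 Eeta0 fin0].
have [eta [Eeta fin inj]] := minimal_traces Eeta0 fin0.
have [zeta Ezeta idem] := ellis_left_ideal_idempotent Eeta.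
have sub := traces_left (eta := eta) Ezeta.
exists (zeta \o eta); split=> //; first exact: ellis_comp.
  exact: sub_finite_set fin.
move=> xi Exi S T /set_mem/sub/mem_set SU /set_mem/sub/mem_set TU.
exact: inj.
Qed.

End TraceAction.

Section TracePermutations.
Context (G : topologicalGroupType) (X Y : flowType G) (f : X -> Y).
Context (U : set X) (eps : {ptws X -> X}).
Hypothesis f_morphism : flow_morphism f.
Hypothesis Eeps : ellis eps.
Hypothesis f_eps : f \o eps = f.
Hypothesis eps_finite : finite_set (traces U eps).
Hypothesis eps_inj : forall zeta : {ptws X -> X}, ellis zeta ->
  {in traces U eps &, injective (fun S => zeta @^-1` S)}.

Local Notation Phi := (fset_set (traces U eps)).

(** [g] and [s] are related when some [zeta \o eps] acts as [g] on [Y] and as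
    [s] on traces. Distinct choices of [zeta] for the same [g] may give distinct
    permutations. *)
Definition trace_rel (g : G) (s : {perm Phi}) : Prop :=
  exists zeta : {ptws X -> X}, [/\ ellis zeta,
    f \o (zeta \o eps) = gact g \o f &
    forall S : Phi, val (s S) = (zeta \o eps) @^-1` val S].

(** Composition of maps of [X] reverses to preimages, which matches the
    left-to-right product of permutations. *)
Lemma trace_relM g h s t : trace_rel g s -> trace_rel h t ->
  trace_rel (g * h)%g (s * t)%g.
Proof.
move=> [xi [Exi fxi xis]] [zeta [Ezeta fzeta zetat]].
exists (xi \o eps \o zeta); split.
- by apply: ellis_comp => //; exact: ellis_comp.
- apply/funext => x /=.
  rewrite gactM -[gact h (f x)]/((gact h \o f) x) -fzeta.
  exact: (congr1 (fun u => u (zeta (eps x))) fxi).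
- by move=> S; rewrite permM zetat xis.
Qed.

(** [gact g \o eps] acts as [g] on [Y] because [f \o eps = f]. Its preimages map
    traces of [eps] to traces of [eps], and they do so injectively. *)
Lemma trace_rel_total g : exists s, trace_rel g s.
Proof.
have mem_act (S : Phi) : (gact g \o eps : {ptws X -> X}) @^-1` val S \in Phi.
  have := valP S; rewrite [X in is_true X -> _]in_fset_set //.
  move=> /set_mem[xi Exi <-].
  rewrite in_fset_set //; apply/mem_set; exists (xi \o eps \o gact g) => //.
  by apply: ellis_comp; [exact: ellis_comp|exact: ellis_gact].
pose act (S : Phi) : Phi := [` mem_act S]%fset.
have act_inj : injective act.
  move=> S T /(congr1 val) /= ST; apply/val_inj.
  apply: (@eps_inj (gact g \o eps : {ptws X -> X})) => //.
  - by apply: ellis_comp => //; exact: ellis_gact.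
  - by rewrite -in_fset_set //; exact: valP.
  - by rewrite -in_fset_set //; exact: valP.
exists (perm act_inj), (gact g); split=> [||S]; first exact: ellis_gact.
  apply/funext => x /=; rewrite f_morphism.2.
  by rewrite -[f (eps x)]/((f \o eps) x) f_eps.
by rewrite permE.
Qed.

(** The trace used is [eps @^-1` U] itself: it contains [x], and it is fixed by
    some [zeta \o eps] acting as [g] on [Y]. *)
Lemma trace_kernel_image g x : correspondence_kernel trace_rel g ->
  U (eps x) -> (f @` U) (gact g (f x)).
Proof.
move=> [zeta [_ fzeta zeta1]] Ux.
have memS : eps @^-1` U \in Phi.
  rewrite in_fset_set //; apply/mem_set; exists (gact 1%g).
    exact: ellis_gact.
  by apply/seteqP; split=> z; rewrite /= gact1.
have := zeta1 [` memS]%fset; rewrite perm1 /= => eqS.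
have {Ux} : (eps @^-1` U) x by [].
rewrite eqS => Ux; exists (eps (zeta (eps x))) => //.
rewrite -[LHS]/((f \o eps) (zeta (eps x))) f_eps.
exact: (congr1 (fun u => u x) fzeta).
Qed.

Lemma trace_partition : clopen U -> minimal_flow Y ->
  exists r : invariant_partition Y,
    forall x, (forall x', f x' = f x -> U x') -> r (f x) `<=` f @` U.
Proof.
move=> [_ cU] Y_minimal.
have [D D_finite DN] := correspondence_kernel_index trace_relM trace_rel_total.
exists (orbit_closure_partition Y_minimal
  (correspondence1 trace_relM trace_rel_total)
  (correspondence_kernelM trace_relM)
  (fun g h => correspondence_kernelJ trace_relM trace_rel_total h)
  (correspondence_kernelX trace_relM trace_rel_total) D_finite DN).
move=> x xU; apply: closure_sub_closed.
  apply: compact_closed; first exact: flow_hausdorff.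
  apply: continuous_compact.
    by apply: continuous_subspaceT => z; exact: f_morphism.1.
  exact: subclosed_compact cU flow_compact _.
move=> _ [n Nn <-]; apply: trace_kernel_image => //; apply: xU.
by rewrite -[LHS]/((f \o eps) x) f_eps.
Qed.

End TracePermutations.

(** * Distal factors are profinite *)

Theorem corollary3p21 (G : topologicalGroupType) (X : flowType G) (x0 : X)
  (hx0 : ambit x0) (hX0 : has_clopen_basis X) (hX : sep_fin_EDRdeg X)
  (Y : flowType G) (hfactor : flow_factor X Y) (hdistal : distal Y)
  (hminimal : minimal_flow Y) :
  profinite_flow Y.
Proof.
have [f f_morphism f_surj] := hfactor.
apply: profinite_of_partitions => y W oW Wy.
have [x _ fx] : range f y by rewrite f_surj.
have [||x' /= -> //|U [cU xU UW]] :=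
    @clopen_between X (f @^-1` [set y]) (f @^-1` W) hX0.
- apply: (subclosed_compact _ flow_compact) => //.
  apply: preimage_closed => [z _|]; first exact: f_morphism.1.
  exact/accessible_closed_set1/hausdorff_accessible/flow_hausdorff.
- by apply: open_comp oW => z _; exact: f_morphism.1.
have [eps [Eeps idem fin inj]] := minimal_idempotent x0 cU hX.
have f_eps := distal_factor_idempotent f_morphism hdistal Eeps idem.
have [r rP] := trace_partition f_morphism Eeps f_eps fin inj cU hminimal.
exists r; rewrite -fx => z /(rP x)[x' ex'|x' Ux' <-]; last exact: UW.
by apply: xU; rewrite /= ex' fx.
Qed.
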